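(* For every integer $n \ge 1$, every sum-free set $A \subseteq [n]$ such that $2n+1 \notin \sum A$ satisfies $$|A| \le \left\lfloor \tfrac{1}{3}(n+1) \right\rfloor .$$
   Context: $[n]=\{1,\ldots,n\}$. A set $A$ of integers is sum-free if there are no (not necessarily distinct) $x,y,z\in A$ with $x+y=z$. For $k \ge 0$, $kA=\{a_1+\cdots+a_k \mid a_1,\ldots,a_k\in A\}$ (repetitions allowed, $0A=\{0\}$), and $\sum A=\bigcup_{k\ge 0} kA$. *)

(* Defs.v *)
From mathcomp Require Import all_boot finmap.

Set Implicit Arguments.
Unset Strict Implicit.
Unset Printing Implicit Defensive.

Definition interval (n : nat) : {fset nat} := [fset i in iota 1 n]%fset.

Definition sum_free (A : {fset nat}) : Prop :=
  forall x y z : nat, x \in A -> y \in A -> z \in A -> x + y <> z.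

(* [in_kfold A k m] is m \in kA; for k = 0 the only tuple is empty, so 0A = {0}. *)
Definition in_kfold (A : {fset nat}) (k m : nat) : Prop :=
  exists a : k.-tuple nat,
    (forall i : 'I_k, tnth a i \in A) /\ m = \sum_(i < k) tnth a i.

(* [in_sums A m] is m \in \sum A, the union of the kA over k >= 0. *)
Definition in_sums (A : {fset nat}) (m : nat) : Prop :=
  exists k : nat, in_kfold A k m.

Lemma in_interval (n x : nat) : (x \in interval n) = (1 <= x <= n).
Proof. by rewrite !inE /= mem_iota add1n ltnS. Qed.

(* Main.v *)
(** Put N = 2n+1. The semigroup generated by A contains at most one of x and
    N - x, so folding [1, 2n] by x |-> min(x, N - x) is injective on the disjoint
    union of A and A + A, whence |A| + |A + A| <= n. Since |A + A| >= 2|A| - 1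
    (already a + A and b + A, for a = min A and b = max A, meet only in a + b),
    this gives 3|A| <= n + 1. *)
Require Import Defs.
From mathcomp Require Import all_boot finmap.
From mathcomp Require Import zify.

Set Implicit Arguments.
Unset Strict Implicit.
Unset Printing Implicit Defensive.

(** Lists carry no length in their type, so adding two sums becomes concatenation. *)
Lemma in_sumsP (A : {fset nat}) (m : nat) :
  in_sums A m <-> exists2 s : seq nat, {subset s <= A} & m = sumn s.
Proof.
split=> [[k [a [aA ->]]] | [s sA ->]].
  exists a; first by move=> x /tnthP[i ->].
  by rewrite sumnE big_tuple.
exists (size s), (in_tuple s); split; first by move=> i; apply/sA/mem_tnth.
by rewrite sumnE (big_tuple _ _ (in_tuple s)).
Qed.

Lemma in_sums_mem (A : {fset nat}) (x : nat) : x \in A -> in_sums A x.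
Proof.
move=> xA; apply/in_sumsP; exists [:: x]; last by rewrite /= addn0.
by move=> y; rewrite inE => /eqP ->.
Qed.

Lemma in_sumsD (A : {fset nat}) (x y : nat) :
  in_sums A x -> in_sums A y -> in_sums A (x + y).
Proof.
move=> /in_sumsP[s sA ->] /in_sumsP[t tA ->]; apply/in_sumsP.
exists (s ++ t); last by rewrite sumn_cat.
by move=> z; rewrite mem_cat => /orP[/sA|/tA].
Qed.

Lemma fset_nat_min_max (A : {fset nat}) (x : nat) : x \in A ->
  exists a b, [/\ a \in A, b \in A & forall y, y \in A -> a <= y <= b].
Proof.
move=> xA; have exA : exists y, y \in A by exists x.
(* A crude upper bound, needed only for a maximum to exist. *)
have ubA y : y \in A -> y <= \sum_(z <- enum_fset A) z.
  by move=> yA; rewrite (big_rem y) //= leq_addr.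
case: (ex_minnP exA) => a aA a_min; case: (ex_maxnP exA ubA) => b bA b_max.
by exists a, b; split=> // y yA; rewrite a_min ?b_max.
Qed.

(* The list [t] stands for a + A followed by b + (A \ {a}). *)
Lemma sumset_lower_bound (A : {fset nat}) : exists t : seq nat,
  [/\ uniq t, 2 * #|` A|%fset <= (size t).+1 &
      forall z, z \in t -> exists x y, [/\ x \in A, y \in A & z = x + y]].
Proof.
case: (fset_0Vmem A) => [-> | [x /fset_nat_min_max[a [b [aA bA abP]]]]].
  by exists [::]; rewrite cardfs0.
have uA := fset_uniq A.
exists (map (addn a) (enum_fset A) ++ map (addn b) (rem a (enum_fset A))); split.
- rewrite cat_uniq !map_inj_uniq ?rem_uniq ?uA ?andbT //=; try exact: addnI.
  (* If [b + y = a + z], then [z <= b] and [a <= y] force [y = a], the element removed from the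
     second copy. *)
  apply/hasPn=> _ /mapP[y + ->]; rewrite mem_rem_uniq // inE => /andP[yNa yA].
  apply/negP=> /mapP[z zA]; have := abP y yA; have := abP z zA.
  by move/eqP: yNa; lia.
- by rewrite size_cat !size_map size_rem //; case: (size _) => [|k] //=; lia.
- move=> z; rewrite mem_cat => /orP[] /mapP[y yA ->]; first by exists a, y.
  by exists b, y; split=> //; apply: (mem_rem yA).
Qed.

Theorem theorem1p1 (n : nat) (hn : 1 <= n) (A : {fset nat})
  (hA : (A `<=` interval n)%fset) (hsf : sum_free A)
  (hsum : ~ in_sums A (2 * n + 1)) :
  #|` A|%fset <= (n + 1) %/ 3.
Proof.
have [t [t_uniq t_size tP]] := sumset_lower_bound A.
have A_bound x : x \in A -> 1 <= x <= n.
  by move=> /(fsubsetP hA); rewrite in_interval.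
pose s := enum_fset A ++ t.
have s_uniq : uniq s.
  (* Sum-freeness keeps the sums in [t] out of [A]. *)
  rewrite cat_uniq fset_uniq t_uniq andbT /=; apply/hasPn=> z /tP[x [y [xA yA zE]]].
  by apply/negP=> zA; apply: (hsf x y z).
have sP z : z \in s -> in_sums A z /\ 1 <= z <= 2 * n.
  rewrite mem_cat => /orP[zA | /tP[x [y [xA yA ->]]]].
    by split; [apply: in_sums_mem | have := A_bound z zA; lia].
  split; first by apply: in_sumsD; apply: in_sums_mem.
  by have := A_bound x xA; have := A_bound y yA; lia.
pose fold z := minn z (2 * n + 1 - z).
have fold_inj : {in s &, injective fold}.
  move=> x y /sP[xS x_bound] /sP[yS y_bound]; rewrite /fold => fold_xy.
  (* Both are at most [2 * n], so the subtractions in [fold] are not truncated. *)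
  have [//|xy_sum] : x = y \/ x + y = 2 * n + 1 by lia.
  by case: hsum; rewrite -xy_sum; apply: in_sumsD.
have : size (map fold s) <= size (iota 1 n).
  apply: uniq_leq_size; first by rewrite map_inj_in_uniq.
  (* [z] and [2 * n + 1 - z] are positive with odd sum [2 * n + 1], so the smaller is at most
     [n]. *)
  by move=> _ /mapP[z /sP[_ z_bound] ->]; rewrite mem_iota /fold; lia.
rewrite size_map size_iota size_cat leq_divRL //.
by move: t_size; move: (size t) (size (enum_fset A)) => l k; lia.
Qed.
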